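(* Let $n>1$ and let $NC(10n+5,5)$ be the number of non-isomorphic cyclic $(K_{10n+5},C_5)$-designs. Then there is an integer $N$ such that for all $n\ge N$: - if $n\equiv 3,5,24,26\pmod{28}$, then $NC(10n+5,5)\ge (38.4)^n$; - if $n\not\equiv 3,5,24,26\pmod{28}$, then $NC(10n+5,5)\ge (29.7)^n$.
   Context: A $(K_v,C_k)$-design (or $k$-cycle system of the complete graph $K_v$) is a set $\mathcal{B}$ of $k$-cycles of $K_v$ whose edges partition the edge-set of $K_v$. It is cyclic if the vertex-set can be identified with $\mathbb{Z}_v$ in such a way that $B=(b_1,\dots,b_k)\in\mathcal{B}$ implies $B+z=(b_1+z,\dots,b_k+z)\in\mathcal{B}$ for all $z\in\mathbb{Z}_v$. Two $(K_v,C_k)$-designs with cycle sets $\mathcal{B}$ and $\mathcal{B}'$ are isomorphic if there is a permutation of the vertex-set turning $\mathcal{B}$ into $\mathcal{B}'$. $NC(v,k)$ is the number of cyclic $(K_v,C_k)$-designs up to isomorphism. *)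

(* Defs.v *)
From mathcomp Require Import all_boot all_order all_fingroup all_algebra.

Set Implicit Arguments.
Unset Strict Implicit.
Unset Printing Implicit Defensive.

Import GRing.Theory.

(* An edge is a 2-element set of vertices. A cycle (b_1, ..., b_k) is          *)
(* represented by its set of edges, so that tuples differing by a rotation or  *)
(* a reflection give the same cycle.                                           *)

Definition complete_graph (V : finType) : {set {set V}} :=
  [set e : {set V} | #|e| == 2].

Definition cycle_graph (V : finType) (c : seq V) : {set {set V}} :=
  [set [set x; next c x] | x in c].

Definition is_cycle (V : finType) (k : nat) (C : {set {set V}}) : bool :=
  (2 < k) && [exists c : k.-tuple V, uniq c && (C == cycle_graph c)].

Definition cycle_design (V : finType) (k : nat) (B : {set {set {set V}}}) : bool :=
  [forall C in B, is_cycle k C] && partition B (complete_graph V).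

Definition map_cycle (V W : finType) (f : V -> W) (C : {set {set V}}) :
    {set {set W}} :=
  [set f @: e | e : {set V} in C].

Definition map_design (V W : finType) (f : V -> W) (B : {set {set {set V}}}) :
    {set {set {set W}}} :=
  [set map_cycle f C | C : {set {set V}} in B].

Definition isomorphic (V : finType) (B B' : {set {set {set V}}}) : bool :=
  [exists s : {perm V}, map_design s B == B'].

(* The vertex set of K_v is 'Z_v, which has v elements only when 1 < v.        *)

Definition translation_closed (v : nat) (B : {set {set {set 'Z_v}}}) : bool :=
  [forall C in B, forall z : 'Z_v, map_cycle (fun x => x + z)%R C \in B].

(* The permutation s is the identification of the vertex set with Z_v: being   *)
(* cyclic does not depend on the labelling of the vertices.                    *)
Definition cyclic_design (v : nat) (k : nat) (B : {set {set {set 'Z_v}}}) : bool :=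
  cycle_design k B &&
  [exists s : {perm 'Z_v}, translation_closed (map_design s B)].

Definition NC (v k : nat) : nat :=
  #|equivalence_partition (@isomorphic 'Z_v) [set B | cyclic_design k B]|.

(* Main.v *)
(* A word (w_0, ..., w_4) over Z_v with sum 0 is developed, by translation, into
   5-cycles whose consecutive differences are the w_i; words whose entries use
   each difference up to sign exactly once give a cyclic design. For v = 10n+5
   the differences 2n+1 and 4n+2 are used by two constant words, and the
   remaining 5n by n words, about half of which consist of three differences of
   signed sum -1 followed by two consecutive integers. Such triples and pairs
   can be matched by an arbitrary permutation, so there are at least (n/2)!
   distinct translation-closed designs.

   The points fixed by a set of automorphisms form a subsystem, and when F is a
   proper subsystem of G, 3|F| < 2|G|. Hence an automorphism group has order at
   most v^O(log v), and an isomorphism class contains at most v |Aut B|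
   translation-closed designs. As (n/2)!/v^O(log v) outgrows every exponential,
   both bounds hold at once, whatever n mod 28. *)
Require Import Defs.
From mathcomp Require Import all_boot all_order all_algebra.
From mathcomp Require Import all_fingroup zify ring.
Import Order.TTheory GRing.Theory Num.Theory.

Set Implicit Arguments.
Unset Strict Implicit.
Unset Printing Implicit Defensive.

(** * Subsystems and automorphisms *)

Lemma set2_inj (T : finType) (x y a b : T) :
  [set x; y] = [set a; b] -> (x = a /\ y = b) \/ (x = b /\ y = a).
Proof.
move=> E.
have: x \in [set a; b] by rewrite -E set21.
have: y \in [set a; b] by rewrite -E set22.
have: a \in [set x; y] by rewrite E set21.
have: b \in [set x; y] by rewrite E set22.
rewrite !inE; do 4!case/orP=> /eqP ?; subst; by [left | right].
Qed.

Lemma mem_cycle_graph (V : finType) (c : seq V) (x y : V) :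
  [set x; y] \in cycle_graph c ->
  [/\ x \in c, y \in c & y = next c x \/ x = next c y].
Proof.
case/imsetP=> u uc /set2_inj [] [-> ->]; rewrite mem_next uc; split=> //.
  by left.
by right.
Qed.

Lemma next_cycle_graph (V : finType) (c : seq V) (x : V) :
  x \in c -> [set x; next c x] \in cycle_graph c.
Proof. by move=> xc; apply/imsetP; exists x. Qed.

Lemma iter_nextP (V : finType) (c : seq V) (x y : V) :
  uniq c -> x \in c -> y \in c -> exists i, y = iter i (next c) x.
Proof.
move=> Uc xc yc; have := fconnect_cycle (cycle_next Uc) xc y.
by rewrite yc => h; exists (findex (next c) x y); rewrite iter_findex.
Qed.

(** Walk along the cycle. If [s] fixes u and its successor, it sends the next edge to an edge at
    that successor, so the vertex after it goes to itself or to u. As [s] is injective and fixes u,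
    the second case makes that vertex equal to u. *)
Lemma map_cycle_id_fix (V : finType) (c : seq V) (s : {perm V}) (x : V) :
    uniq c -> map_cycle s (cycle_graph c) = cycle_graph c ->
    x \in c -> s x = x -> s (next c x) = next c x ->
  {in c, forall y, s y = y}.
Proof.
move=> Uc Hs xc sx sx' y yc; have [i ->] := iter_nextP Uc xc yc.
have ic j : iter j (next c) x \in c by elim: j => //= j; rewrite mem_next.
have: s (iter i (next c) x) = iter i (next c) x /\
      s (next c (iter i (next c) x)) = next c (iter i (next c) x).
  elim: i => [|i [IH IH']] //=; split=> //.
  set u := iter i _ x in IH IH' *.
  have uc : u \in c by exact: ic.
  have: [set next c u; s (next c (next c u))] \in cycle_graph c.
    rewrite -{1}IH' -Hs; apply/imsetP; exists [set next c u; next c (next c u)].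
      by apply: next_cycle_graph; rewrite mem_next.
    by rewrite imsetU1 imset_set1.
  case/mem_cycle_graph => _ _ [] // /(can_inj (prev_next Uc)) e.
  by move: e; rewrite -{1}IH => /perm_inj <-.
by case.
Qed.

Definition aut_design (V : finType) (B : {set {set {set V}}}) : {set {perm V}} :=
  [set s : {perm V} | map_design s B == B].

Lemma map_cycle_comp (V W X : finType) (f : V -> W) (g : W -> X) C :
  map_cycle g (map_cycle f C) = map_cycle (g \o f) C.
Proof.
rewrite /map_cycle -imset_comp; apply: eq_imset => e /=.
by rewrite -imset_comp.
Qed.

Lemma map_design_comp (V W X : finType) (f : V -> W) (g : W -> X) B :
  map_design g (map_design f B) = map_design (g \o f) B.
Proof.
rewrite /map_design -imset_comp; apply: eq_imset => e /=.
by rewrite map_cycle_comp.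
Qed.

Lemma eq_map_cycle (V W : finType) (f g : V -> W) :
  f =1 g -> map_cycle f =1 map_cycle g.
Proof.
by move=> fg C; rewrite /map_cycle; apply: eq_imset => e /=; apply: eq_imset.
Qed.

Lemma eq_map_design (V W : finType) (f g : V -> W) :
  f =1 g -> map_design f =1 map_design g.
Proof. by move=> fg B; apply: eq_imset; apply: eq_map_cycle. Qed.

Lemma map_cycle_id (V : finType) (C : {set {set V}}) : map_cycle id C = C.
Proof.
by rewrite /map_cycle (eq_imset _ (@imset_id V)) imset_id.
Qed.

Lemma map_design_id (V : finType) (B : {set {set {set V}}}) : map_design id B = B.
Proof. by rewrite /map_design (eq_imset _ (@map_cycle_id V)) imset_id. Qed.

Lemma map_design_perm1 (V : finType) (B : {set {set {set V}}}) :
  map_design (1%g : {perm V}) B = B.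
Proof. by rewrite (eq_map_design (@perm1 V)) map_design_id. Qed.

Lemma map_design_permM (V : finType) (s t : {perm V}) B :
  map_design (s * t)%g B = map_design t (map_design s B).
Proof. by rewrite map_design_comp; apply: eq_map_design => x; rewrite permM. Qed.

Lemma aut_design_group_set (V : finType) (B : {set {set {set V}}}) :
  group_set (aut_design B).
Proof.
apply/group_setP; split=> [|s t]; first by rewrite inE map_design_perm1.
by rewrite !inE map_design_permM => /eqP-> /eqP->.
Qed.

Canonical aut_design_group V B := Group (@aut_design_group_set V B).

(** In a design each pair of points lies on one cycle, so this closure makes the cycles through
    pairs of [F] a design on [F]. Single points qualify, which lets a stabilizer chain start from
    one. *)
Definition subsystem (V : finType) (B : {set {set {set V}}}) (F : {set V}) : Prop :=
  forall C e e',
    C \in B -> e \in C -> e' \in C -> e \subset F -> e' \subset F.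

Lemma cycle_designP (V : finType) (k : nat) (B : {set {set {set V}}}) C :
  cycle_design k B -> C \in B ->
  exists2 c : k.-tuple V, uniq c & C = cycle_graph c.
Proof.
by case/andP=> /forall_inP H _ /H /andP[_ /existsP[c /andP[Uc /eqP->]]]; exists c.
Qed.

Lemma cycle_design_edge (V : finType) (k : nat) (B : {set {set {set V}}}) C e :
  cycle_design k B -> C \in B -> e \in C -> #|e| = 2.
Proof.
case/andP=> _ /and3P[/eqP covB _ _] CB eC.
have: e \in complete_graph V by rewrite -covB; apply/bigcupP; exists C.
by rewrite inE => /eqP.
Qed.

Lemma cycle_design_cycle_eq (V : finType) (k : nat) (B : {set {set {set V}}}) C C' e :
  cycle_design k B -> C \in B -> C' \in B -> e \in C -> e \in C' -> C = C'.
Proof.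
case/andP=> _ /and3P[_ /trivIsetP tB _] CB C'B eC eC'.
case: (eqVneq C C') => // /(tB _ _ CB C'B) /disjointFr/(_ eC).
by rewrite eC'.
Qed.

(** An automorphism fixing both ends of an edge preserves the unique cycle through that edge, hence
    fixes this cycle pointwise. *)
Lemma subsystem_afix (V : finType) (k : nat) (B : {set {set {set V}}}) (H : {set {perm V}}) :
  cycle_design k B -> H \subset aut_design B -> subsystem B ('Fix_('P)(H))%g.
Proof.
move=> dB HA C e e' CB eC e'C eF; apply/subsetP=> y ye'.
apply/afixP=> s sH; rewrite /= apermE.
have [c Uc EC] := cycle_designP dB CB.
have fixF x : x \in e -> s x = x.
  by move/(subsetP eF)/afixP/(_ s sH); rewrite /= apermE.
have HC : map_cycle s C = C.
  apply: (cycle_design_cycle_eq (e := e) dB) => //.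
    have := subsetP HA _ sH; rewrite inE => /eqP <-.
    exact: imset_f.
  apply/imsetP; exists e => //; apply/esym.
  by rewrite -[RHS]imset_id; apply: eq_in_imset => x /fixF.
have /imsetP[x xc Ee] : e \in cycle_graph c by rewrite -EC.
apply: (@map_cycle_id_fix V c s x) => //; rewrite ?fixF -?EC // ?Ee ?set21 ?set22 //.
have /imsetP[u uc Ee'] : e' \in cycle_graph c by rewrite -EC.
by move: ye'; rewrite Ee' !inE => /orP[] /eqP-> //; rewrite mem_next.
Qed.

Lemma complete_graph_card2 (V : finType) (x y : V) :
  ([set x; y] \in complete_graph V) = (x != y).
Proof. by rewrite inE cards2; case: (x != y). Qed.

(* A 5-cycle is not bipartite, so it cannot alternate between F and its
   complement. *)
Lemma cycle5_edge_outside (V : finType) (c : 5.-tuple V) (F : {set V}) :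
    uniq c -> (forall e, e \in cycle_graph c -> ~~ (e \subset F)) ->
  exists2 e, e \in cycle_graph c & e \subset ~: F.
Proof.
move=> Uc HF; case: (boolP [exists e in cycle_graph c, e \subset ~: F]).
  by case/exists_inP=> e; exists e.
rewrite negb_exists_in => /forall_inP HD.
have alt x : x \in c -> (next c x \in F) = (x \notin F).
  move=> /next_cycle_graph xe; have := HF _ xe; have := HD _ xe.
  rewrite !subUset !sub1set !inE.
  by case: (x \in F); case: (next c x \in F).
case: c Uc alt {HF HD} => [[|a [|b [|c [|d [|e [|//]]]]]] //= i5].
rewrite !inE !negb_or -!andbA andbT.
case/and5P=> ab ac ad ae /and5P[bc bd be cd /andP[ce de]] alt.
have := alt a; have := alt b; have := alt c; have := alt d; have := alt e.
rewrite /= !inE !eqxx !orbT /=.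
rewrite ![b == a]eq_sym ![c == a]eq_sym ![d == a]eq_sym ![e == a]eq_sym.
rewrite ![c == b]eq_sym ![d == b]eq_sym ![e == b]eq_sym.
rewrite ![d == c]eq_sym ![e == c]eq_sym ![e == d]eq_sym.
rewrite (negPf ab) (negPf ac) (negPf ad) (negPf ae) (negPf bc) (negPf bd).
rewrite (negPf be) (negPf cd) (negPf ce) (negPf de).
move=> /(_ isT) + /(_ isT) + /(_ isT) + /(_ isT) + /(_ isT).
by case: (a \in F); case: (b \in F); case: (c \in F); case: (d \in F);
  case: (e \in F).
Qed.

Lemma card_cycle_graph_le (V : finType) (c : seq V) : #|cycle_graph c| <= size c.
Proof. exact: leq_trans (leq_imset_card _ _) (card_size _). Qed.

Lemma card_crossing (V : finType) (F G : {set V}) :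
    [disjoint F & G] ->
  #|F| * #|G| <=
    #|[set e in complete_graph V |
        [exists x in F, [exists y in G, e == [set x; y]]]]|.
Proof.
move=> FG; rewrite -cardsX.
rewrite -(card_in_imset (f := fun p : V * V => [set p.1; p.2])); last first.
  move=> [x y] [x' y'] /setXP[xF yG] /setXP[xF' yG'] /= /set2_inj [[-> ->]|[E1 E2]] //.
  by move: xF; rewrite E1 (disjointFl FG yG').
apply/subset_leq_card/subsetP=> _ /imsetP[[x y] /setXP[/= xF yG] ->].
rewrite inE complete_graph_card2; apply/andP; split.
  by apply: contraTneq xF => ->; rewrite (disjointFl FG yG).
by apply/exists_inP; exists x => //; apply/exists_inP; exists y.
Qed.

(* Every cycle of B with an edge between F and G :\: F has all its vertices in
   G and has an edge inside G :\: F, so at most four edges of the first kind. *)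
Lemma subsystem_growth (V : finType) (B : {set {set {set V}}}) (F G : {set V}) :
    cycle_design 5 B -> subsystem B F -> subsystem B G -> F \proper G ->
  3 * #|F| < 2 * #|G|.
Proof.
have arith1 (a b : nat) : 0 < b -> a + b <= 5 -> a <= 4 * b by lia.
(* Here f = |F|, h = |G \ F| and b = h(h-1)/2. From fh <= 2h(h-1) follows f < 2h, which is the
   growth claim. *)
have arith2 (f h b : nat) : 0 < h -> h * h.-1 = 2 * b -> f * h <= 4 * b ->
    3 * f < 2 * (f + h).
  move=> h0 E; have -> : 4 * b = 2 * h.-1 * h by lia.
  by rewrite leq_pmul2r //; lia.
move=> dB sF sG /properP[FG [w wG wF]].
set H := G :\: F.
set X := [set e in complete_graph V |
           [exists x in F, [exists y in H, e == [set x; y]]]].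
set O := [set e in complete_graph V | e \subset H].
have FH : [disjoint F & H] by rewrite disjoint_sym disjoints_subset subsetDr.
have cX : #|F| * #|H| <= #|X| by exact: card_crossing.
have cO : #|O| = 'C(#|H|, 2).
  rewrite -cards_draws; apply: eq_card => e; rewrite !inE.
  by rewrite andbC.
have HC C : C \in B -> #|X :&: C| <= 4 * #|O :&: C|.
  move=> CB; have [->|[e /setIP[eX eC]]] := set_0Vmem (X :&: C).
    by rewrite cards0.
  have [c Uc EC] := cycle_designP dB CB.
  have := eX; rewrite inE => /andP[eK].
  case/exists_inP=> x xF /exists_inP[y yH /eqP Ee].
  have yG : y \in G /\ y \notin F by move: yH; rewrite inE => /andP[].
  have eG : e \subset G by rewrite Ee subUset !sub1set (subsetP FG) // yG.1.
  have CF e' : e' \in C -> ~~ (e' \subset F).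
    move=> e'C; apply/negP => e'F; have := sF _ _ _ CB e'C eC e'F.
    by rewrite Ee subUset !sub1set (negPf yG.2) andbF.
  have [f fc fF] : exists2 f, f \in cycle_graph c & f \subset ~: F.
    by apply: cycle5_edge_outside => // f; rewrite -EC; apply: CF.
  have fO : f \in O :&: C.
    rewrite !inE EC fc andbT -EC in eC *.
    have fC : f \in C by rewrite EC.
    rewrite (cycle_design_edge dB CB fC) eqxx /= /H setDE subsetI fF andbT.
    exact: sG CB eC fC eG.
  have O0 : 0 < #|O :&: C| by apply/card_gt0P; exists f.
  (* Of the five edges of [C] at least one lies in [O], so at most four lie in [X]. *)
  suff h : #|X :&: C| + #|O :&: C| <= 5 by exact: arith1 O0 h.
  have dXO : [disjoint X :&: C & O :&: C].
    rewrite -setI_eq0; apply/eqP/setP=> g; rewrite !inE.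
    apply/negP => /andP[/andP[/andP[_ /exists_inP[a aF /exists_inP[b _ /eqP ->]]] _]].
    case/andP=> /andP[_]; rewrite subUset sub1set => /andP[aH _] _.
    by rewrite (disjointFr FH aF) in aH.
  have [_] := leq_card_setU (X :&: C) (O :&: C); rewrite dXO => /eqP <-.
  have := card_cycle_graph_le c; rewrite size_tuple; apply: leq_trans.
  by apply/subset_leq_card; rewrite -EC subUset !subsetIr.
have XO : #|X| <= 4 * #|O|.
  have pB : partition B (complete_graph V) by case/andP: dB.
  have cnt (Y : {set {set V}}) : Y \subset complete_graph V ->
      #|Y| = \sum_(C in B) #|Y :&: C|.
    move=> YK; rewrite -sum1_card.
    rewrite (eq_bigl (fun e => (e \in complete_graph V) && (e \in Y))); last first.
      by move=> e; case: (boolP (e \in Y)) => [/(subsetP YK)->|]; rewrite ?andbF.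
    rewrite (set_partition_big_cond _ pB) /=; apply: eq_bigr => C _.
    by rewrite -sum1_card; apply: eq_bigl => e; rewrite inE andbC.
  rewrite !cnt; try by apply/subsetP=> e; rewrite inE => /andP[].
  by rewrite big_distrr; apply: leq_sum.
have H0 : 0 < #|H| by apply/card_gt0P; exists w; rewrite inE wF.
have cG : #|G| = #|F| + #|H| by rewrite -(cardsID F G) (setIidPr FG).
rewrite cG; apply: (arith2 _ _ #|O|) => //; last exact: leq_trans cX XO.
by have := mul_bin_diag #|H| 1; rewrite bin1 cO.
Qed.

Lemma afix_full_card1 (V : finType) (H : {group {perm V}}) :
  ('Fix_('P)(H))%g = [set: V] -> #|H| = 1.
Proof.
move=> FT; suff -> : H = 1%G by rewrite cards1.
apply/trivGP/subsetP=> s sH; rewrite inE; apply/eqP/permP=> x; rewrite perm1.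
have : x \in ('Fix_('P)(H))%g by rewrite FT inE.
by move=> /afixP/(_ s sH); rewrite /= apermE.
Qed.

(** Induction along a stabilizer chain. Stabilizing one more non-fixed point costs an orbit of at
    most |V| points and, by [subsystem_growth], enlarges the fixed set by a factor above 3/2. The
    numerical hypothesis reads |V| <= (3/2)^t |Fix H|, so t such steps reach the trivial group. *)
Lemma card_aut_design_afix (V : finType) (B : {set {set {set V}}}) (t : nat)
    (H : {group {perm V}}) :
    0 < #|V| -> cycle_design 5 B -> H \subset aut_design B ->
    2 ^ t * #|V| <= 3 ^ t * #|('Fix_('P)(H))%g| -> #|H| <= #|V| ^ t.
Proof.
move=> V0 dB; elim: t H => [|t IH] H HA.
  rewrite !mul1n => h; rewrite afix_full_card1 //.
  by apply/eqP; rewrite eqEcard subsetT cardsT.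
move=> h; case: (eqVneq ('Fix_('P)(H))%g [set: V]) => [FT|FT].
  by rewrite afix_full_card1 // expn_gt0 V0.
have [x xF] : exists x, x \notin ('Fix_('P)(H))%g.
  by move: FT; rewrite -subTset => /subsetPn[x _ xF]; exists x.
rewrite -(card_orbit_stab 'P H x) expnS leq_mul ?max_card //.
have sA : 'C_H[x | 'P]%g \subset aut_design B by exact: subset_trans (subsetIl _ _) HA.
apply: IH => //.
have pr : ('Fix_('P)(H))%g \proper ('Fix_('P)('C_H[x | 'P]))%g.
  apply/properP; split; first exact: (afixS _ (subsetIl _ _)).
  by exists x => //; apply/afixP=> s /setIP[_ /astab1P].
have := subsystem_growth dB (subsystem_afix dB HA) (subsystem_afix dB sA) pr.
have arith (a b v p q : nat) : 2 * p * v <= 3 * q * a -> 3 * a < 2 * b ->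
    p * v <= q * b by nia.
by apply: arith; rewrite -!expnS.
Qed.

(** One point is stabilized first to make the fixed set nonempty. Then 2s steps suffice, because 4^s
    |V| <= 8^s <= 9^s. *)
Lemma card_aut_design (V : finType) (B : {set {set {set V}}}) (s : nat) :
  0 < #|V| <= 2 ^ s -> cycle_design 5 B -> #|aut_design B| <= #|V| ^ (s.*2).+1.
Proof.
move=> /andP[V0 Vs] dB; have [x _] := card_gt0P V0.
rewrite -(card_orbit_stab 'P (aut_design_group B) x) expnS leq_mul ?max_card //.
apply: (card_aut_design_afix (B := B)) => //; first exact: subsetIl.
have fx : 0 < #|('Fix_('P)('C_(aut_design B)[x | 'P]))%g|.
  by apply/card_gt0P; exists x; apply/afixP=> g /setIP[_ /astab1P].
apply: (@leq_trans (3 ^ s.*2)); last by rewrite leq_pmulr.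
rewrite -mul2n !expnM; apply: (@leq_trans ((2 ^ 2) ^ s * 2 ^ s)).
  by rewrite leq_mul2l Vs orbT.
by rewrite -expnMn; case: (s) => // k; rewrite leq_exp2r.
Qed.

(** * Isomorphism classes of translation-closed designs *)

Lemma card_map_design (V : finType) (s : {perm V}) (B : {set {set {set V}}}) :
  #|map_design s B| = #|B|.
Proof.
rewrite card_imset //; apply: (can_inj (g := map_cycle (s^-1)%g)) => C.
rewrite map_cycle_comp (eq_map_cycle (g := id)) ?map_cycle_id // => x /=.
by rewrite permK.
Qed.

Lemma translation_cycle_perm (v : nat) (s : {perm 'Z_v}) (B : {set {set {set 'Z_v}}}) :
    translation_closed (map_design s B) ->
  (s * perm (addIr (1%R : 'Z_v)) * s^-1)%g \in aut_design B.
Proof.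
move=> tc; rewrite inE !map_design_permM; set B' := map_design s B in tc *.
suff -> : map_design (perm (addIr (1%R : 'Z_v))) B' = B'.
  by rewrite -map_design_permM mulgV map_design_perm1.
have sub : map_design (perm (addIr (1%R : 'Z_v))) B' \subset B'.
  apply/subsetP=> _ /imsetP[C CB ->].
  rewrite (eq_map_cycle (g := fun x => (x + 1)%R)); last by move=> x; rewrite permE.
  by move/forall_inP: tc => /(_ C CB)/forallP.
by apply/eqP; rewrite eqEcard sub !card_map_design leqnn.
Qed.

(* A permutation s onto a translation-closed design is determined by the
   automorphism x |-> s^-1 (s x + 1) of B and by the preimage of 0. *)
Lemma card_isomorphic_translation_closed (v : nat) (B : {set {set {set 'Z_v}}}) :
  #|[set B' | isomorphic B B' && translation_closed B']| <=
    #|'Z_v| * #|aut_design B|.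
Proof.
set T := [set s : {perm 'Z_v} | translation_closed (map_design s B)].
apply: (@leq_trans #|T|).
  apply: leq_trans (leq_imset_card (fun s : {perm 'Z_v} => map_design s B) T).
  apply/subset_leq_card/subsetP=> B'; rewrite inE => /andP[/existsP[s /eqP <-] tc].
  by apply/imsetP; exists s; rewrite ?inE.
pose f (s : {perm 'Z_v}) :=
  (s^-1%g (0%R : 'Z_v), (s * perm (addIr (1%R : 'Z_v)) * s^-1)%g).
rewrite -(card_in_imset (f := f)); last first.
  move=> s t _ _ [E0 E1].
  have E x : (s^-1 (x + 1)%R = s^-1 (perm (addIr (1%R : 'Z_v)) (s (s^-1 x))))%g.
    by rewrite permKV permE.
  have E' x : (t^-1 (x + 1)%R = t^-1 (perm (addIr (1%R : 'Z_v)) (t (t^-1 x))))%g.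
    by rewrite permKV permE.
  (* The inverses of s and t agree at 0 and, by [E] and [E'], obey the same recursion from x to x +
     1. *)
  apply: invg_inj; apply/permP=> x; rewrite -[x]natr_Zp.
  elim: (nat_of_ord x) => [|k IH]; first exact: E0.
  rewrite -natr1 E E' -IH -!permM.
  by move/permP: E1 => /(_ (s^-1%g (k%:R)%R)); rewrite !permM.
rewrite -cardsT -cardsX; apply/subset_leq_card/subsetP=> _ /imsetP[s sT ->].
by rewrite inE /= inE translation_cycle_perm //; move: sT; rewrite inE.
Qed.

Lemma isomorphic_refl (V : finType) (B : {set {set {set V}}}) : isomorphic B B.
Proof. by apply/existsP; exists 1%g; rewrite map_design_perm1. Qed.

Lemma translation_closed_cyclic (v k : nat) (B : {set {set {set 'Z_v}}}) :
  cycle_design k B -> translation_closed B -> cyclic_design k B.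
Proof.
by move=> dB tB; rewrite /cyclic_design dB; apply/existsP; exists 1%g;
  rewrite map_design_perm1.
Qed.

Lemma card_class_le_NC (v s : nat) (T : {set {set {set {set 'Z_v}}}}) :
    1 < v <= 2 ^ s -> {in T, forall B, cycle_design 5 B} ->
    {in T, forall B, translation_closed B} ->
  #|T| <= NC v 5 * v ^ (s.*2).+2.
Proof.
move=> /andP[v1 vs] dT tT.
pose D := [set B : {set {set {set 'Z_v}}} | cyclic_design 5 B].
(* [cl] is the block function of [equivalence_partition], so its image on [D] is what [NC] counts.
   By reflexivity, designs with the block of B are isomorphic to B. *)
pose cl B := [set B' in D | isomorphic B B'].
have TD : T \subset D.
  by apply/subsetP=> B BT; rewrite inE translation_closed_cyclic ?dT ?tT.
have cv : #|'Z_v| = v by rewrite card_ord Zp_cast.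
rewrite -sum1_card (partition_big_imset cl) /=.
apply: (@leq_trans (\sum_(K in cl @: T) v ^ (s.*2).+2)); last first.
  by rewrite sum_nat_const leq_mul2r subset_leq_card ?orbT // imsetS.
apply: leq_sum => K /imsetP[B BT ->]; rewrite sum1dep_card.
apply: (@leq_trans #|[set B' | isomorphic B B' && translation_closed B']|).
  apply/subset_leq_card/subsetP=> B'; rewrite !inE => /andP[B'T /eqP E].
  rewrite tT // andbT.
  have : B' \in cl B' by rewrite inE (subsetP TD) ?isomorphic_refl.
  by rewrite E inE => /andP[].
apply: leq_trans (card_isomorphic_translation_closed B) _.
rewrite expnS cv leq_mul2l -[X in _ <= X ^ _]cv card_aut_design ?orbT ?dT //.
by rewrite cv vs andbT ltnW.
Qed.

(** * Growth of the factorial *)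

(** With a = K^4, the m - a factors of m! above a give m! >= K^(4(m-a)), and 4a < 2m makes this
    exponent at least 2m + 1. *)
Lemma expn_le_fact (K m : nat) : 0 < K -> 4 * K ^ 4 < 2 * m -> K ^ (2 * m).+1 <= m`!.
Proof.
move=> K0; set a := K ^ 4 => am.
have a0 : 0 < a by rewrite expn_gt0 K0.
have leam : a <= m by lia.
have h : a ^ (m - a) <= m`!.
  rewrite -{2}(subnK leam); move: (m - a) => d.
  elim: d => [|d IH]; first by rewrite expn0 fact_gt0.
  by rewrite expnS addSn factS leq_mul //; lia.
apply: leq_trans h; rewrite -expnM leq_pexp2l //.
by move: a am leam {a0} => a; lia.
Qed.

(** Combined with 2^(s-1) < 10n + 5, this yields s(2s+2) <= n; 13 is the least s for which it
    holds. *)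
Lemma square_le_expn (s : nat) : 13 <= s -> 20 * s ^ 2 + 20 * s + 6 <= 2 ^ s.-1.
Proof.
elim: s => // s IH; rewrite leq_eqVlt => /predU1P[<-|] //.
rewrite ltnS => s13; have := IH s13.
case: s s13 {IH} => // s s13 /=; rewrite -!mulnn expnS; move: (2 ^ s) => p; nia.
Qed.

(** With v = 10n + 5 <= 2^s, the factor v^(2s+2) is at most 2^(s(2s+2)) <= 2^n, so the left side is
    at most (2K)^n and [expn_le_fact] applies to 2K. In the threshold, 2^13 forces s >= 13 and the
    rest serves [expn_le_fact]. *)
Lemma fact_ge_expn_quasipoly (K : nat) : 0 < K ->
  exists N, forall n, N <= n ->
    K ^ n * (10 * n + 5) ^ (up_log 2 (10 * n + 5)).*2.+2 <= (n./2)`!.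
Proof.
move=> K0; exists (2 ^ 13 + 4 * (2 * K) ^ 4 + 2) => n hn.
set v := 10 * n + 5; set s := up_log 2 v.
have vs : v <= 2 ^ s by exact: up_logP.
have sv : 2 ^ s.-1 < v by apply: up_log_gtn => //; lia.
have s13 : 13 <= s.
  rewrite leqNgt; apply/negP => s12.
  have : v <= 2 ^ 13 by apply: leq_trans vs _; rewrite leq_pexp2l // ltnW.
  by rewrite /v; move: hn; move: (2 ^ 13) (_ ^ 4) => p q; lia.
have hs : s * (s.*2).+2 <= n.
  by have := square_le_expn s13; rewrite -mulnn; move: (2 ^ s.-1) sv => p;
    rewrite /v -mul2n; lia.
apply: (@leq_trans ((2 * K) ^ n)).
  rewrite expnMn mulnC leq_mul2r; apply/orP; right.
  apply: leq_trans (leq_pexp2l _ hs) => //.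
  by rewrite expnM leq_exp2r.
apply: (@leq_trans ((2 * K) ^ (2 * n./2).+1)).
  by rewrite leq_pexp2l //; lia.
apply: expn_le_fact; first by lia.
by move: hn; move: (2 ^ 13) (_ ^ 4) => p q; lia.
Qed.

Local Open Scope ring_scope.

(** * Designs from words over Z_v *)

Definition offset (v : nat) (w : 'I_5 -> 'Z_v) (i : 'I_5) : 'Z_v :=
  \sum_(j < 5 | (j < i)%N) w j.

(** The walk from [z] with steps [w i]; it returns to [z] exactly when the entries sum to 0. *)
Definition lift_cycle (v : nat) (w : 'I_5 -> 'Z_v) (z : 'Z_v) : {set {set 'Z_v}} :=
  [set [set z + offset w i; z + offset w i + w i] | i : 'I_5].

(** As an image set it merges coinciding translates, so a constant word d with 5d = 0 contributes
    its short orbit once. *)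
Definition lift_design (v : nat) (I : finType) (w : I -> 'I_5 -> 'Z_v) :
    {set {set {set 'Z_v}}} :=
  [set lift_cycle (w p.1) p.2 | p : I * 'Z_v].

Lemma sum_ord5 (v : nat) (w : 'I_5 -> 'Z_v) :
  \sum_j w j = w (@Ordinal 5 0 isT) + w (@Ordinal 5 1 isT) + w (@Ordinal 5 2 isT)
    + w (@Ordinal 5 3 isT) + w (@Ordinal 5 4 isT).
Proof.
rewrite !big_ord_recl big_ord0 addr0 !addrA.
by do !congr (_ + _); congr (w _); apply: val_inj.
Qed.

Lemma offset_nth (v : nat) (w : 'I_5 -> 'Z_v) (i : 'I_5) :
  offset w i = nth 0 [:: 0; w (@Ordinal 5 0 isT);
    w (@Ordinal 5 0 isT) + w (@Ordinal 5 1 isT);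
    w (@Ordinal 5 0 isT) + w (@Ordinal 5 1 isT) + w (@Ordinal 5 2 isT);
    w (@Ordinal 5 0 isT) + w (@Ordinal 5 1 isT) + w (@Ordinal 5 2 isT)
      + w (@Ordinal 5 3 isT)] i.
Proof.
rewrite /offset big_mkcond sum_ord5 /=.
by case: i => -[|[|[|[|[|//]]]]] i5 /=; rewrite !(addr0, add0r).
Qed.

Lemma offset_ordS (v : nat) (w : 'I_5 -> 'Z_v) (i : 'I_5) :
  \sum_j w j = 0 -> offset w (ordS i) = offset w i + w i.
Proof.
rewrite sum_ord5 !offset_nth.
case: i => -[|[|[|[|[|//]]]]] i5; rewrite /= ?modnn ?modn_small // ?add0r => w0.
5: rewrite /= -[LHS]w0.
all: by congr (_ + w _) || congr (w _); apply: val_inj.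
Qed.

(** Two partial sums differ by the sum over an arc of the cyclic word. An arc of length one or two
    is handled by [K]; a longer one is replaced, by [K'], with its complement, the total being 0. *)
Lemma partial_sums_uniq (R : comNzRingType) (a b c d e : R) :
    a + b + c + d + e = 0 ->
    [&& a != 0, b != 0, c != 0, d != 0 & e != 0] ->
    [&& a + b != 0, b + c != 0, c + d != 0, d + e != 0 & e + a != 0] ->
  uniq [:: 0; a; a + b; a + b + c; a + b + c + d].
Proof.
move=> s0 /and5P[a0 b0 c0 d0 e0] /and5P[ab bc cd de ea].
have K (x y t : R) : t != 0 -> x - y = - t -> x != y.
  by move=> t0 E; rewrite -subr_eq0 E oppr_eq0.
have K' (x y t : R) : t != 0 -> x - y = t - (a + b + c + d + e) -> x != y.
  by move=> t0 E; rewrite -subr_eq0 E s0 subr0.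
rewrite /= !inE !negb_or -!andbA !andbT; repeat (apply/andP; split).
- by apply: (K _ _ a) => //; ring.
- by apply: (K _ _ (a + b)) => //; ring.
- by apply: (K' _ _ (d + e)) => //; ring.
- by apply: (K' _ _ e) => //; ring.
- by apply: (K _ _ b) => //; ring.
- by apply: (K _ _ (b + c)) => //; ring.
- by apply: (K' _ _ (e + a)) => //; ring.
- by apply: (K _ _ c) => //; ring.
- by apply: (K _ _ (c + d)) => //; ring.
- by apply: (K _ _ d) => //; ring.
Qed.

Lemma offset_inj (v : nat) (w : 'I_5 -> 'Z_v) :
    \sum_j w j = 0 -> (forall i j, w i + w j != 0) -> injective (offset w).
Proof.
move=> + w2; have w1 i : w i != 0 by apply: contra (w2 i i) => /eqP->; rewrite addr0.
rewrite sum_ord5 => w0 i j; rewrite !offset_nth => /eqP.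
rewrite nth_uniq //; first by move/eqP/val_inj.
by apply: (partial_sums_uniq w0); rewrite ?w1 ?w2.
Qed.

Lemma next_ord5 (i : 'I_5) : next (enum 'I_5) i = ordS i.
Proof.
apply: val_inj; rewrite -(next_map val_inj) ?val_enum_ord ?enum_uniq //.
by case: i => -[|[|[|[|[|//]]]]].
Qed.

Lemma lift_cycle_is_cycle (v : nat) (w : 'I_5 -> 'Z_v) (z : 'Z_v) :
    \sum_j w j = 0 -> injective (offset w) ->
  is_cycle 5 (lift_cycle w z).
Proof.
move=> w0 winj; have finj : injective (fun i => z + offset w i) by move=> i j /addrI/winj.
pose c := [tuple of [seq z + offset w i | i <- ord_tuple 5]].
have Ec : c = [seq z + offset w i | i <- enum 'I_5] :> seq _ by rewrite -val_ord_tuple.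
have nextc i : next c (z + offset w i) = z + offset w i + w i.
  by rewrite -addrA -offset_ordS // -next_ord5 Ec (next_map finj) ?enum_uniq.
apply/existsP; exists c; rewrite {1}Ec map_inj_uniq // enum_uniq /=; apply/eqP.
apply/setP=> e; apply/imsetP/imsetP=> [[i _ ->]|[x]].
  exists (z + offset w i); first by rewrite Ec; apply: map_f; rewrite mem_enum.
  by rewrite nextc.
by rewrite Ec => /mapP[i _ ->]; rewrite -Ec nextc => ->; exists i.
Qed.

Lemma map_lift_cycle (v : nat) (w : 'I_5 -> 'Z_v) (z t : 'Z_v) :
  map_cycle (fun x => x + t) (lift_cycle w z) = lift_cycle w (z + t).
Proof.
rewrite /map_cycle /lift_cycle -imset_comp; apply: eq_imset => i /=.
by rewrite imsetU1 imset_set1; congr [set _; _]; ring.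
Qed.

Lemma lift_design_translation_closed (v : nat) (I : finType) (w : I -> 'I_5 -> 'Z_v) :
  translation_closed (lift_design w).
Proof.
apply/forall_inP=> _ /imsetP[[j z] _ ->]; apply/forallP=> t.
by rewrite map_lift_cycle; apply/imsetP; exists (j, z + t).
Qed.

(* The third hypothesis is stated with equal cycles rather than equal indices
   because it must allow the constant words (d, ..., d) with 5 d = 0. *)
Lemma lift_design_cycle_design (v : nat) (I : finType) (w : I -> 'I_5 -> 'Z_v) :
    (forall j, \sum_i w j i = 0) ->
    (forall d, d != 0 -> exists j i, d = w j i \/ d = - w j i) ->
    (forall j i j' i', w j i = w j' i' -> forall x,
       lift_cycle (w j) (x - offset (w j) i) =
       lift_cycle (w j') (x - offset (w j') i')) ->
    (forall j i j' i', w j i + w j' i' != 0) ->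
  cycle_design 5 (lift_design w).
Proof.
move=> w0 wcov wuniq wopp.
have wn0 j i : w j i != 0 by apply: contra (wopp j i j i) => /eqP->; rewrite addr0.
have winj j : injective (offset (w j)) by apply: offset_inj.
apply/andP; split.
  by apply/forall_inP=> _ /imsetP[[j z] _ ->]; apply: lift_cycle_is_cycle.
apply/and3P; split.
- apply/eqP/setP=> e; apply/bigcupP/idP.
    case=> _ /imsetP[[j z] _ ->] /imsetP[i _ ->].
    rewrite complete_graph_card2; apply: contra (wn0 j i) => /eqP E.
    by apply/eqP/(addrI (z + offset (w j) i)); rewrite -E addr0.
  rewrite inE => /cards2P[x [y [xy ->]]].
  have /wcov[j [i E]] : y - x != 0 by rewrite subr_eq0 eq_sym.
  have mem_lift u : [set u; u + w j i] \in lift_cycle (w j) (u - offset (w j) i).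
    by apply/imsetP; exists i; rewrite ?subrK.
  case: E => E; [exists (lift_cycle (w j) (x - offset (w j) i)) |
                 exists (lift_cycle (w j) (y - offset (w j) i))].
  - by apply/imsetP; exists (j, x - offset (w j) i).
  - by have := mem_lift x; rewrite -E addrC subrK.
  - by apply/imsetP; exists (j, y - offset (w j) i).
  - have := mem_lift y; rewrite -[w j i]opprK -E opprB addrC subrK.
    by rewrite setUC.
- apply/trivIsetP=> _ _ /imsetP[[j z] _ ->] /imsetP[[j' z'] _ ->] /=.
  apply: contraR => /pred0Pn[e /andP[/imsetP[i _ E] /imsetP[i' _ E']]].
  (* If both cycles traverse the common edge in the same direction, its differences agree and
     [wuniq] identifies the cycles. In opposite directions the differences sum to 0, against
     [wopp]. *)
  move: E'; rewrite E => /set2_inj[[E1 E2]|[E1 E2]].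
    have {E2} : w j i = w j' i' by move: E2; rewrite E1 => /addrI.
    move/wuniq/(_ (z + offset (w j) i)); rewrite {2}E1 !addrK => ->.
    exact: eqxx.
  case/negP: (wopp j i j' i'); apply/eqP/(addrI (z + offset (w j) i)).
  by rewrite addr0 addrA E2 -E1.
- apply/imsetP=> -[[j z] _] /setP/(_ [set z + offset (w j) ord0;
                                    z + offset (w j) ord0 + w j ord0]).
  by rewrite inE => /esym/negP; apply; apply/imsetP; exists ord0.
Qed.

Lemma intr_Zp_inj (v : nat) (a b : int) :
  (1 < v)%N -> (`|a| + `|b| < v)%N -> a%:~R = b%:~R :> 'Z_v -> a = b.
Proof.
move=> v1 ab E; have : (a - b)%:~R = 0 :> 'Z_v by rewrite rmorphB /= E subrr.
have kill k : (k < v)%N -> k%:R = 0 :> 'Z_v -> k = 0%N.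
  move=> kv /(congr1 (@nat_of_ord _)); by rewrite val_Zp_nat // modn_small.
have abv : (`|a - b| < v)%N by lia.
move=> h; have {h} : `|a - b|%N%:R = 0 :> 'Z_v.
  rewrite -[_%:R]/(_%:Z%:~R); case: (intP (a - b)) h => [|k|k] //=.
  by rewrite rmorphN /= => h; apply: oppr_inj; rewrite oppr0.
by move/(kill _ abv)/eqP; rewrite absz_eq0 subr_eq0 => /eqP.
Qed.

(** For a constant word d the cycle is invariant under translation by d, and every offset is a
    multiple of d. *)
Lemma lift_cycle_const (v : nat) (w : 'I_5 -> 'Z_v) (i j : 'I_5) (x : 'Z_v) :
    \sum_k w k = 0 -> (forall k l, w k = w l) ->
  lift_cycle w (x - offset w i) = lift_cycle w (x - offset w j).
Proof.
move=> w0 wc.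
have step z : lift_cycle w (z + w ord0) = lift_cycle w z.
  have E k : z + w ord0 + offset w k = z + offset w (ordS k).
    by rewrite offset_ordS // (wc k ord0) addrA addrAC.
  apply/setP=> e; apply/imsetP/imsetP=> [[k _ ->]|[k _ ->]].
    by exists (ordS k); rewrite // E (wc k (ordS k)).
  by exists (ord_pred k); rewrite // E ord_predK (wc (ord_pred k) k).
have all k : lift_cycle w (x - offset w k) = lift_cycle w x.
  have -> : offset w k = w ord0 *+ k.
    rewrite /offset (eq_bigr (fun=> w ord0)) => [|l _]; last exact: wc.
    rewrite sumr_const; congr (_ *+ _).
    by rewrite -sum1_card (big_ord_narrow (ltnW (ltn_ord k))) /= sum1_card card_ord.
  elim: (nat_of_ord k) => [|l IH]; first by rewrite subr0.
  by rewrite -step mulrS opprD addrA addrAC subrK IH.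
by rewrite !all.
Qed.

Definition int_design (v : nat) (I : finType) (G : I -> 'I_5 -> int) :=
  @lift_design v I (fun j i => (G j i)%:~R).

(** As 10n + 5 = 2(5n+2) + 1, each nonzero residue is a or -a for a unique a in 1..5n+2. Opposite
    entries would share an absolute value, hence be equal and vanish. *)
Lemma int_design_cycle_design (n : nat) (I : finType) (G : I -> 'I_5 -> int) :
    let v := (10 * n + 5)%N in
    (forall j, (\sum_i G j i)%:~R = 0 :> 'Z_v) ->
    (forall j i, 0 < `|G j i| <= 5 * n + 2)%N ->
    (forall a, (0 < a <= 5 * n + 2)%N -> exists j i, `|G j i|%N = a) ->
    (forall j i j' i', `|G j i|%N = `|G j' i'|%N ->
       j = j' /\ (i = i' \/ forall k l, G j k = G j l)) ->
  cycle_design 5 (int_design v G).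
Proof.
have arith x : (5 * n + 2 < x -> x < 10 * n + 5 -> 10 * n + 5 - x <= 5 * n + 2)%N.
  by lia.
move=> v G0 Gb Gs Gi; have v1 : (1 < v)%N by rewrite /v; lia.
have Geq j i j' i' : `|G j i|%N = `|G j' i'|%N -> G j i = G j' i'.
  by case/Gi => <- [<-|].
apply: lift_design_cycle_design => [j|d d0|j i j' i' E x|j i j' i'].
- by rewrite -rmorph_sum /= G0.
- have [a [a1 a2 Ea]] : exists a,
      [/\ (0 < a)%N, (a <= 5 * n + 2)%N & d = a%:R \/ d = - a%:R].
    case: (leqP d (5 * n + 2)) => dn.
      exists d; split=> //; last by left; rewrite natr_Zp.
      by rewrite lt0n; apply: contra d0 => /eqP d0; apply/eqP/val_inj.
    exists (v - d)%N.
    have dv : (d < v)%N by rewrite -{2}(Zp_cast v1).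
    split; [by rewrite subn_gt0 | exact: arith dn dv | right].
    by rewrite natrB ?(ltnW dv) // (pchar_Zp v1) sub0r opprK natr_Zp.
  have [|j [i Ga]] := Gs a; first by rewrite a1.
  exists j, i; move: Ea; rewrite -Ga.
  case: (intP (G j i)) => [|k|k]; rewrite ?abszN ?absz_nat ?rmorphN ?opprK /=; tauto.
- have {E} E : G j i = G j' i'.
    by apply: (intr_Zp_inj v1) E; have := Gb j i; have := Gb j' i'; rewrite /v; lia.
  have [<- [<-|Gc]] // : j = j' /\ (i = i' \/ forall k l, G j k = G j l).
    by apply: Gi; rewrite E.
  by apply: lift_cycle_const => [|k l]; rewrite -?rmorph_sum /= ?G0 // (Gc k l).
- apply/negP=> /eqP E.
  have {E} : G j i = - G j' i'.
    apply: (intr_Zp_inj v1); last by rewrite rmorphN; apply/eqP; rewrite -addr_eq0 E.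
    by have := Gb j i; have := Gb j' i'; rewrite /v; lia.
  move=> E; have E' : `|G j i|%N = `|G j' i'|%N by rewrite E abszN.
  by have := Geq _ _ _ _ E'; have := Gb j i; lia.
Qed.

(** * The words for v = 10n + 5 *)

(* The words [word_swap n k l] have the partial sum -1 over the first three
   entries, whatever k is, so that k and l can be matched arbitrarily. *)
Definition word_swap (n k l : nat) : seq int :=
  [:: (4 * k + 3)%N%:Z; (4 * n - 2 * k)%N%:Z; - (4 * n + 4 + 2 * k)%N%:Z;
      (4 * l + 2)%N%:Z; - (4 * l + 1)%N%:Z].

(** The triple sums to 2 and is balanced by a pair p, p + 2. The pairs for k = 2i and 2i + 1 fill
    four consecutive integers, so an odd [n./2] leaves the last k exceptional. For n = 2 mod 4 it
    takes 3n, 3n + 1 and an all-positive triple, for a total of 10n + 5; for n = 3 mod 4 it takes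
    2n, 2n + 2. The shift of p skips the values above 2n + 1 reserved for that last word and for
    [word_odd]. *)
Definition word_rest (n k : nat) : seq int :=
  let p := (2 * n + 2 + nth 0 [:: 0; 1; 0; 3] (n %% 4) + 4 * (k %/ 2) + k %% 2)%N in
  if (n %% 4 == 2)%N && (k.+1 == n./2)%N then
    [:: (2 * n)%N%:Z; (3 * n + 3)%N%:Z; (5 * n + 1)%N%:Z;
        (3 * n + 1)%N%:Z; - (3 * n)%N%:Z]
  else if (n %% 4 == 3)%N && (k.+1 == n./2)%N then
    [:: (4 * k + 4)%N%:Z; (4 * n + 1 - 2 * k)%N%:Z; - (4 * n + 3 + 2 * k)%N%:Z;
        (2 * n)%N%:Z; - (2 * n + 2)%N%:Z]
  else
    [:: (4 * k + 4)%N%:Z; (4 * n + 1 - 2 * k)%N%:Z; - (4 * n + 3 + 2 * k)%N%:Z;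
        p%:Z; - (p + 2)%N%:Z].

(** For odd n, the single word made of the differences left over; its sum is 10n + 5 when n = 1 mod
    4 and 0 when n = 3 mod 4. *)
Definition word_odd (n : nat) : seq int :=
  if (n %% 4 == 1)%N then
    [:: (5 * n + 2)%N%:Z; (3 * n + 2)%N%:Z; (2 * n - 1)%N%:Z; - (2 * n)%N%:Z;
        (2 * n + 2)%N%:Z]
  else
    [:: (2 * n - 1)%N%:Z; (3 * n + 2)%N%:Z; - (5 * n + 2)%N%:Z;
        (2 * n + 4)%N%:Z; - (2 * n + 3)%N%:Z].

Definition word (n : nat) (f : nat -> nat) (j : nat) : seq int :=
  if (j < n./2)%N then word_swap n j (f j)
  else if (j < 2 * n./2)%N then word_rest n (j - n./2)
  else word_odd n.

Lemma size_word n f j : size (word n f j) = 5%N.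
Proof. by rewrite /word /word_rest /word_odd; do !case: ifP. Qed.

Lemma sum_word n f j : (3 < n)%N -> (j < n)%N ->
  \sum_(i < 5) nth 0 (word n f j) i = 0 \/
  \sum_(i < 5) nth 0 (word n f j) i = (10 * n + 5)%N%:Z.
Proof.
move=> n3 jn; rewrite /word /word_rest /word_odd.
have r4 : (n %% 4 < 4)%N by rewrite ltn_mod.
do !case: ifP => ?; rewrite !big_ord_recl big_ord0 /= addr0.
all: lia.
Qed.

(** The range is cut into intervals. Up to 4⌊n/2⌋ the residue mod 4 selects the word; on the 2⌊n/2⌋
    values up to 4n + 1 and the 2⌊n/2⌋ values from 4n + 3, parity does. Between 2n + 2 and 3n + 1
    lie mostly the pairs of [word_rest]; the remaining values arise only for odd n. *)
Lemma mem_word n f a : (3 < n)%N ->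
    (forall l, (l < n./2)%N -> exists2 k, (k < n./2)%N & f k = l) ->
    (0 < a <= 5 * n + 2)%N -> a != (2 * n + 1)%N -> a != (4 * n + 2)%N ->
  exists2 j, (j < n)%N & a \in [seq `|x|%N | x <- word n f j].
Proof.
move=> n3 fs a0 a1 a2.
have swap k : (k < n./2)%N -> a \in [:: 4 * k + 3; 4 * n - 2 * k; 4 * n + 4 + 2 * k]%N ->
    exists2 j, (j < n)%N & a \in [seq `|x|%N | x <- word n f j].
  move=> kn ak; exists k; first by lia.
  rewrite /word kn /= abszN !absz_nat; move: ak; rewrite !inE.
  by case/or3P=> ->; rewrite ?orbT.
have pair l : (l < n./2)%N -> a \in [:: 4 * l + 1; 4 * l + 2]%N ->
    exists2 j, (j < n)%N & a \in [seq `|x|%N | x <- word n f j].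
  move=> /fs[k kn <-] ak; exists k; first by lia.
  rewrite /word kn /= !abszN !absz_nat; move: ak; rewrite !inE.
  by case/orP=> ->; rewrite ?orbT.
have rest k : (k < n./2)%N -> a \in [seq `|x|%N | x <- word_rest n k] ->
    exists2 j, (j < n)%N & a \in [seq `|x|%N | x <- word n f j].
  move=> kn ak; exists (n./2 + k)%N; first by lia.
  rewrite /word ifF; last by lia.
  by rewrite ifT ?addKn //; lia.
have extra : odd n -> a \in [seq `|x|%N | x <- word_odd n] ->
    exists2 j, (j < n)%N & a \in [seq `|x|%N | x <- word n f j].
  move=> on ak; exists n.-1; first by lia.
  by rewrite /word ifF ?ifF //; lia.
have rest3 k : (k < n./2)%N -> a \in [:: 4 * k + 4; 4 * n + 1 - 2 * k; 4 * n + 3 + 2 * k]%N ->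
    exists2 j, (j < n)%N & a \in [seq `|x|%N | x <- word n f j].
  move=> kn; rewrite !inE => ak; apply: (rest k) => //; rewrite /word_rest.
  by do !case: ifP => ?; rewrite /= !(abszN, absz_nat) !inE; lia.
have r4 : (n %% 4 < 4)%N by rewrite ltn_mod.
case: (leqP a (4 * n./2)) => [al|al].
  case E : ((a - 1) %% 4)%N => [|[|[|[|r]]]]; last by lia.
  - by apply: (pair ((a - 1) %/ 4)%N); rewrite ?inE; lia.
  - by apply: (pair ((a - 1) %/ 4)%N); rewrite ?inE; lia.
  - by apply: (swap ((a - 1) %/ 4)%N); rewrite ?inE; lia.
  - by apply: (rest3 ((a - 1) %/ 4)%N); rewrite ?inE; lia.
case: (leqP a (2 * n)) => [al2|al2].
  case: (boolP ((a == 2 * n) && (n %% 4 == 3)))%N => [ar|ar].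
    apply: (rest n./2.-1); first by lia.
    case/andP: ar => /eqP -> /eqP E.
    by rewrite /word_rest E /= ifT; [rewrite /= !(abszN, absz_nat) ?inE; lia | lia].
  apply: extra; first by lia.
  by rewrite /word_odd; case: ifP => ?; rewrite /= !(abszN, absz_nat) !inE; lia.
case: (ltnP (4 * n + 2) a) => [ag|ag].
  case: (leqP a (4 * n + 2 + 2 * n./2)) => [al3|al3].
    case: (boolP (odd a)) => oa.
      by apply: (rest3 ((a - 4 * n - 3) %/ 2)%N); rewrite ?inE; lia.
    by apply: (swap ((a - 4 * n - 4) %/ 2)%N); rewrite ?inE; lia.
  apply: extra; first by lia.
  by rewrite /word_odd; case: ifP => ?; rewrite /= !(abszN, absz_nat) !inE; lia.
case: (ltnP (4 * n + 1 - 2 * n./2) a) => [ay|ay].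
  case: (boolP (odd a)) => oa.
    by apply: (rest3 ((4 * n + 1 - a) %/ 2)%N); rewrite ?inE; lia.
  by apply: (swap ((4 * n - a) %/ 2)%N); rewrite ?inE; lia.
case: (leqP a (3 * n + 1)) => [al3|al3]; last first.
  apply: extra; first by lia.
  by rewrite /word_odd; case: ifP => ?; rewrite /= !(abszN, absz_nat) !inE; lia.
case E : (n %% 4)%N r4 => [|[|[|[|//]]]] _.
(* Inverts the pairing: at distance d = 4i + r from the first p, the value a lies in the pair of
   index 2i + (r mod 2). *)
- pose d := (a - (2 * n + 2))%N.
  apply: (rest (2 * (d %/ 4) + (d %% 2))%N); rewrite /d; first by lia.
  by rewrite /word_rest E /= !(abszN, absz_nat) !inE; lia.
- case: (ltnP (2 * n + 2) a) => ad; last first.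
    apply: extra; first by lia.
    by rewrite /word_odd E /= !(abszN, absz_nat) !inE; lia.
  pose d := (a - (2 * n + 3))%N.
  apply: (rest (2 * (d %/ 4) + (d %% 2))%N); rewrite /d; first by lia.
  by rewrite /word_rest E /= !(abszN, absz_nat) !inE; lia.
- case: (leqP (3 * n) a) => ad.
    apply: (rest n./2.-1); first by lia.
    by rewrite /word_rest E /= ifT; [rewrite /= !(abszN, absz_nat) ?inE; lia | lia].
  pose d := (a - (2 * n + 2))%N.
  apply: (rest (2 * (d %/ 4) + (d %% 2))%N); rewrite /d; first by lia.
  by rewrite /word_rest E /= ifF; [rewrite /= !(abszN, absz_nat) ?inE; lia | lia].
- case: (ltnP (2 * n + 4) a) => ad.
    pose d := (a - (2 * n + 5))%N.
    apply: (rest (2 * (d %/ 4) + (d %% 2))%N); rewrite /d; first by lia.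
    by rewrite /word_rest E /= ifF; [rewrite /= !(abszN, absz_nat) ?inE; lia | lia].
  case: (eqVneq a (2 * n + 2)%N) => ad2.
    apply: (rest n./2.-1); first by lia.
    by rewrite /word_rest E /= ifT; [rewrite /= !(abszN, absz_nat) ?inE; lia | lia].
  apply: extra; first by lia.
  by rewrite /word_odd E /= !(abszN, absz_nat) !inE; lia.
Qed.

(* [inl j] indexes the n full orbits, [inr b] the two orbits of length 2n+1. *)
Definition family (n : nat) (f : nat -> nat) (x : 'I_n + bool) (i : 'I_5) : int :=
  match x with
  | inl j => nth 0 (word n f j) i
  | inr b => (if b then 4 * n + 2 else 2 * n + 1)%N%:Z
  end.

Definition onto_half (n : nat) (f : nat -> nat) : Prop :=
  forall l, (l < n./2)%N -> exists2 k, (k < n./2)%N & f k = l.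

Lemma family_surj n f a : (3 < n)%N -> onto_half n f -> (0 < a <= 5 * n + 2)%N ->
  exists x i, `|@family n f x i|%N = a.
Proof.
move=> n3 fs an.
have [->|a1] := eqVneq a (2 * n + 1)%N; first by exists (inr false), ord0.
have [->|a2] := eqVneq a (4 * n + 2)%N; first by exists (inr true), ord0.
have [j jn /mapP[x xw ax]] := mem_word n3 fs an a1 a2.
have i5 : (index x (word n f j) < 5)%N by rewrite -(size_word n f j) index_mem.
by exists (inl (Ordinal jn)), (Ordinal i5); rewrite /= nth_index.
Qed.

(* The 5n entries of the full words cover a set of 5n absolute values. *)
Lemma family_inl n f : (3 < n)%N -> onto_half n f ->
  injective (fun p : 'I_n * 'I_5 => `|@family n f (inl p.1) p.2|%N) /\
  forall j i, let a := `|@family n f (inl j) i|%N in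
    [&& 0 < a <= 5 * n + 2, a != 2 * n + 1 & a != 4 * n + 2]%N.
Proof.
move=> n3 fs; set g := fun p : 'I_n * 'I_5 => _.
pose D := (iota 1 (2 * n) ++ iota (2 * n + 2) (2 * n) ++ iota (4 * n + 3) n)%N.
have memD a : (a \in D) = [&& 0 < a <= 5 * n + 2, a != 2 * n + 1 & a != 4 * n + 2]%N.
  by rewrite !mem_cat !mem_iota; lia.
have uD : uniq D.
  rewrite !cat_uniq !iota_uniq !andbT /=; apply/andP; split; apply/hasPn=> a;
  by rewrite ?mem_cat !mem_iota; lia.
have sub : {subset D <= codom g}.
  move=> a; rewrite memD => /and3P[a0 a1 a2].
  have [[j|b] [i E]] := family_surj n3 fs a0; first by apply/codomP; exists (j, i).
  by move: E a1 a2 => <-; case: b; rewrite /= eqxx.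
have sz : (size (codom g) <= size D)%N.
  by rewrite size_codom card_prod !card_ord !size_cat !size_iota; lia.
have [_ eqD] := uniq_min_size uD sub sz; split.
  by apply/injectiveP; apply: leq_size_uniq uD sub sz.
by move=> j i; have := codom_f g (j, i); rewrite -eqD memD.
Qed.

(** * Designs indexed by permutations, and the final count *)

Definition design (n : nat) (f : nat -> nat) : {set {set {set 'Z_(10 * n + 5)}}} :=
  int_design (10 * n + 5) (@family n f).

Lemma sum_family n f (x : 'I_n + bool) : (3 < n)%N ->
  (\sum_i family f x i)%:~R = 0 :> 'Z_(10 * n + 5).
Proof.
move=> n3; have v1 : (1 < 10 * n + 5)%N by lia.
have v0 : (10 * n + 5)%N%:R = 0 :> 'Z_(10 * n + 5) by rewrite pchar_Zp.
case: x => [j|b] /=; first by have [->|->] := sum_word f n3 (ltn_ord j).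
rewrite sumr_const card_ord -[_ *+ 5]mulr_natr -PoszM /=.
have -> : ((if b then 4 * n + 2 else 2 * n + 1) * 5 = (10 * n + 5) * (if b then 2 else 1))%N.
  by case: b; lia.
by rewrite -[_%:~R]/(_%:R) natrM v0 mul0r.
Qed.

Lemma design_cycle_design n f : (3 < n)%N -> onto_half n f -> cycle_design 5 (design n f).
Proof.
move=> n3 fs; have [ginj gD] := family_inl n3 fs.
apply: int_design_cycle_design => [x|x i|a an|x i y j].
- exact: sum_family.
- case: x => [j|b]; first by have /and3P[] := gD j i.
  by case: b => /=; lia.
- exact: family_surj.
- case: x y => [x|b] [y|c] E.
  + by have [-> ->] := ginj (x, i) (y, j) E; split; [|left].
  + by have := gD x i; rewrite E; case: c {E} => /=; lia.
  + by have := gD y j; rewrite -E; case: b {E} => /=; lia.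
  + by split; [move: E; case: b; case: c => //=; lia | right].
Qed.

Lemma design_translation_closed n f : translation_closed (design n f).
Proof. exact: lift_design_translation_closed. Qed.

Lemma mem_lift_cycle_diff (v : nat) (w : 'I_5 -> 'Z_v) (z x y : 'Z_v) :
  [set x; y] \in lift_cycle w z -> exists i, y - x = w i \/ y - x = - w i.
Proof.
case/imsetP=> i _ /set2_inj[] [-> ->]; exists i; [left|right].
  by rewrite addrC addKr.
by rewrite opprD addrA subrr sub0r.
Qed.

(** The edge from 0 to 4k + 3 is the first edge of the cycle of word k based at 0, for f and g
    alike. Equal designs thus share this cycle, and the difference 4 f(k) + 1 must occur in the word
    of g. *)
Lemma design_inj n f g : (3 < n)%N -> onto_half n f -> onto_half n g ->
  design n f = design n g -> forall k, (k < n./2)%N -> f k = g k.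
Proof.
move=> n3 fs gs E k kn; have v1 : (1 < 10 * n + 5)%N by lia.
have kn' : (k < n)%N by lia.
pose w h i : 'Z_(10 * n + 5) := (@family n h (inl (Ordinal kn')) i)%:~R.
have wE h i : w h i = (nth 0 (word_swap n k (h k)) i)%:~R.
  by rewrite /w /= /word kn.
have Bw h : lift_cycle (w h) 0 \in design n h.
  by apply/imsetP; exists (inl (Ordinal kn'), 0).
have memi h i :
    [set 0 + offset (w h) i; 0 + offset (w h) i + w h i] \in lift_cycle (w h) 0.
  by apply/imsetP; exists i.
have Ef : lift_cycle (w f) 0 = lift_cycle (w g) 0.
  apply: (cycle_design_cycle_eq (e := [set 0; (4 * k + 3)%N%:R]) _ (Bw f)).
  - exact: design_cycle_design.
  - by rewrite E; apply: Bw.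
  - by have := memi f ord0; rewrite offset_nth /= !add0r wE.
  - by have := memi g ord0; rewrite offset_nth /= !add0r wE.
have := memi f (@Ordinal 5 4 isT); rewrite Ef => /mem_lift_cycle_diff[i].
rewrite addrC addKr !wE /= -!rmorphN => Ei.
have bound h (j : 'I_5) : onto_half n h ->
    (absz (nth 0%R (word_swap n k (h k)) j) <= 5 * n + 2)%N.
  move=> hs; have [_ /(_ (Ordinal kn') j)] := family_inl n3 hs.
  by rewrite /= /word kn => /and3P[/andP[]].
have fb := bound f (@Ordinal 5 4 isT) fs; have gb := bound g i gs.
have {Ei} : absz (nth 0%R (word_swap n k (g k)) i) = (4 * f k + 1)%N.
  rewrite -[RHS]/(`|(4 * f k + 1)%N%:Z|%N) -[RHS]abszN.
  case: Ei => /(intr_Zp_inj v1) -> //; rewrite ?abszN //.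
  - by move: fb gb; rewrite /= ?abszN; lia.
  - by move: fb gb; rewrite /= ?abszN; lia.
(* Only the last entry of [word_swap] has absolute value 1 mod 4. *)
by case: i {gb} => -[|[|[|[|[|//]]]]] /= _; rewrite ?abszN ?absz_nat; lia.
Qed.

Definition perm_nat (m : nat) (s : 'S_m) (k : nat) : nat :=
  if insub k is Some i then s i else 0%N.

Lemma perm_natE (m : nat) (s : 'S_m) (i : 'I_m) : perm_nat s i = s i.
Proof. by rewrite /perm_nat valK. Qed.

Lemma perm_nat_onto (n : nat) (s : 'S_(n./2)) : onto_half n (perm_nat s).
Proof.
move=> l ln; exists (s^-1%g (Ordinal ln)); first exact: ltn_ord.
by rewrite perm_natE permKV.
Qed.

Lemma fact_le_NC (n : nat) : (3 < n)%N ->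
  (n./2`! <= NC (10 * n + 5) 5 * (10 * n + 5) ^ (up_log 2 (10 * n + 5)).*2.+2)%N.
Proof.
move=> n3; have v1 : (1 < 10 * n + 5)%N by lia.
pose D (s : 'S_(n./2)) := design n (perm_nat s).
have Dinj : injective D.
  move=> s t E; apply/permP=> i; apply: val_inj; rewrite /= -!perm_natE.
  by apply: (design_inj n3 _ _ E) => //; apply: perm_nat_onto.
rewrite -card_Sn -cardsT -(card_imset _ Dinj).
apply: card_class_le_NC; first by rewrite v1 up_logP.
  by move=> _ /imsetP[s _ ->]; apply: design_cycle_design => //; apply: perm_nat_onto.
by move=> _ /imsetP[s _ ->]; apply: design_translation_closed.
Qed.

Lemma NC_ge_expn (K : nat) : (0 < K)%N ->
  exists N, forall n, (N <= n)%N -> (K ^ n <= NC (10 * n + 5) 5)%N.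
Proof.
move=> K0; have [N HN] := fact_ge_expn_quasipoly K0; exists (N + 4)%N => n hn.
have n3 : (3 < n)%N by lia.
have nN : (N <= n)%N by lia.
have := leq_trans (HN n nN) (fact_le_NC n3).
by rewrite leq_pmul2r // expn_gt0 addn_gt0 orbT.
Qed.

Theorem proposition6 :
  exists N : nat, forall n : nat, (1 < n)%N -> (N <= n)%N ->
    ((n %% 28)%N \in [:: 3; 5; 24; 26]%N ->
       (384%:R / 10%:R : rat) ^+ n <= (NC (10 * n + 5) 5)%:R) /\
    ((n %% 28)%N \notin [:: 3; 5; 24; 26]%N ->
       (297%:R / 10%:R : rat) ^+ n <= (NC (10 * n + 5) 5)%:R).
Proof.
(* The integer 39 exceeds both 38.4 and 29.7. *)
have [N HN] := @NC_ge_expn 39 isT; exists N => n _ /HN h.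
have le39 (x : rat) : 0 <= x <= 39%:R -> x ^+ n <= (NC (10 * n + 5) 5)%:R.
  case/andP=> x0 x39; apply: le_trans (_ : (39 ^ n)%N%:R <= _); last by rewrite ler_nat.
  by rewrite natrX; apply: lerXn2r.
by split=> _; apply: le39.
Qed.
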